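(* Let $R$ be a commutative ring. (a) Let $I$ be a nonzero proper ideal of $R$. Then $(I, X)$ is an sdf-absorbing ideal of $R[X]$ if and only if $I$ is an sdf-absorbing ideal of $R$. (b) $(X)$ is an sdf-absorbing ideal of $R[X]$ if and only if $R$ is reduced and $\{0\}$ is an sdf-absorbing ideal of $R$.
   Context: All rings are commutative with identity $1 \neq 0$. A proper ideal $I$ of a commutative ring $R$ is a square-difference factor absorbing ideal (sdf-absorbing ideal) of $R$ if whenever $a, b \in R$ are both nonzero and $a^2 - b^2 \in I$, then $a + b \in I$ or $a - b \in I$. A ring is reduced if it has no nonzero nilpotent elements. $(I, X)$ denotes the ideal of $R[X]$ generated by $I$ and $X$. *)

(* Defs.v *)
From mathcomp Require Import all_boot all_algebra ring_quotient.
From mathcomp Require Import boolp classical_sets.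

Set Implicit Arguments.
Unset Strict Implicit.
Unset Printing Implicit Defensive.

Import GRing.Theory.

Local Open Scope classical_set_scope.
Local Open Scope ring_scope.

(* The library's [idealr_closed] is about proper ideals only; [is_ideal] also
   allows the whole ring, as needed to generate ideals.  Closure under
   opposites follows from closure under multiplication by -1.  For proper
   ideals the two notions agree, see [idealr_closedE]. *)
Definition is_ideal (R : comNzRingType) (I : set R) : Prop :=
  [/\ I 0,
      forall a b, I a -> I b -> I (a + b)
    & forall r a, I a -> I (r * a)].

Lemma idealr_closedE (R : comNzRingType) (I : set R) :
  idealr_closed [in I] <-> is_ideal I /\ I <> setT.
Proof.
split=> [[I0 I1 Ilin]|[[I0 ID IM] IT]].
  have in_I x : (x \in [in I]) = (x \in I) by [].
  move: I0 I1; rewrite !in_I => /set_mem I0 /negP I1.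
  have lin r a b : I a -> I b -> I (r * a + b).
    by move=> Ia Ib; apply/set_mem/(Ilin r a b); exact/mem_set.
  split; last by move=> IT; apply: I1; rewrite IT; exact/mem_set.
  split=> // [a b Ia Ib|r a Ia]; first by rewrite -[a]mul1r; exact: lin.
  by rewrite -[r * a]addr0; exact: lin.
split; first exact/mem_set.
  apply/negP => /set_mem I1; apply: IT; apply/seteqP; split=> // x _.
  by rewrite -[x]mulr1; exact: IM.
move=> r a b /set_mem Ia /set_mem Ib; apply/mem_set.
by apply: ID => //; exact: IM.
Qed.

Definition ideal_gen (R : comNzRingType) (S : set R) : set R :=
  smallest (@is_ideal R) S.

Definition sdf_absorbing (R : comNzRingType) (I : set R) : Prop :=
  idealr_closed [in I] /\
  forall a b : R, a != 0 -> b != 0 ->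
    I (a ^+ 2 - b ^+ 2) -> I (a + b) \/ I (a - b).

Definition nilpotent_elt (R : comNzRingType) (x : R) : Prop :=
  exists n : nat, x ^+ n = 0.

Definition reduced_ring (R : comNzRingType) : Prop :=
  forall x : R, nilpotent_elt x -> x = 0.

(* Main.v *)
Require Import Defs.
From mathcomp Require Import all_boot all_algebra ring_quotient.
From mathcomp Require Import boolp classical_sets.

(** Both parts are instances of one equivalence.  The ideal [(I, X)] is
    the preimage of [I] under evaluation at [0], and [(X)] is the case
    [I = 0].  For any proper ideal [I], this preimage is sdf-absorbing if and
    only if [I] is sdf-absorbing and [a ^+ 2 \in I] forces [a \in I]
    ([sdf_absorbing_eval0]).  The sdf condition on [R[X]] transfers to
    constant terms at once, except that a nonzero polynomial may have
    constant term [0]; the condition on squares covers exactly that case.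

    The condition on squares is then identified in each part.  A nonzero
    sdf-absorbing ideal always satisfies it ([sdf_absorbing_sqr]): compare [a]
    with a nonzero element of the ideal.  This settles (a), and it also shows
    that the preimage, which contains ['X != 0], satisfies it.  For [I = 0] the
    condition says that [R] is reduced ([reduced_ringP]), which settles (b). *)

Set Implicit Arguments.
Unset Strict Implicit.
Unset Printing Implicit Defensive.

Import GRing.Theory.

Local Open Scope classical_set_scope.
Local Open Scope ring_scope.

Definition sqr_closed (R : comNzRingType) (I : set R) : Prop :=
  forall a : R, I (a ^+ 2) -> I a.

Definition eval0_preimage (R : comNzRingType) (I : set R) : set {poly R} :=
  [set p | I p.[0]].

Lemma is_idealB (R : comNzRingType) (I : set R) (a b : R) :
  is_ideal I -> I a -> I b -> I (a - b).
Proof. by case=> _ ID IM Ia Ib; apply: ID => //; rewrite -mulN1r; exact: IM. Qed.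

Lemma is_ideal_set0 (R : comNzRingType) : is_ideal [set (0 : R)].
Proof.
by split=> //= [a b -> ->|r a ->]; rewrite ?addr0 ?mulr0.
Qed.

Lemma idealr_closed_set0 (R : comNzRingType) :
  idealr_closed [in [set (0 : R)]].
Proof.
apply/idealr_closedE; split; first exact: is_ideal_set0.
move=> zeroT; have : [set (0 : R)] 1 by rewrite zeroT.
by move=> /= /eqP; rewrite oner_eq0.
Qed.

Lemma is_ideal_eval0 (R : comNzRingType) (I : set R) :
  is_ideal I -> is_ideal (eval0_preimage I).
Proof.
case=> I0 ID IM; split; rewrite /eval0_preimage /=.
- by rewrite horner0.
- by move=> p q Ip Iq; rewrite hornerD; exact: ID.
- by move=> r p Ip; rewrite hornerM; exact: IM.
Qed.

Lemma idealr_closed_eval0 (R : comNzRingType) (I : set R) :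
  idealr_closed [in I] -> idealr_closed [in eval0_preimage I].
Proof.
move=> /idealr_closedE[idI properI]; apply/idealr_closedE.
split; first exact: is_ideal_eval0.
move=> JT; apply: properI; apply/seteqP; split=> // c _.
have : eval0_preimage I c%:P by rewrite JT.
by rewrite /eval0_preimage /= hornerC.
Qed.

(** Division by ['X]: a polynomial is congruent modulo ['X] to its constant
    term. *)
Lemma ideal_mem_eval0 (R : comNzRingType) (K : set {poly R}) (p : {poly R}) :
  is_ideal K -> K 'X -> K (p.[0])%:P -> K p.
Proof.
case=> _ KD KM KX; elim/poly_ind: p => [|q c _]; first by rewrite horner0 polyC0.
rewrite !hornerE => Kc; apply: KD => //; exact: KM.
Qed.

Lemma ideal_gen_polyCX (R : comNzRingType) (I : set R) :
  is_ideal I ->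
  ideal_gen ((@polyC R) @` I `|` [set 'X]) = eval0_preimage I.
Proof.
move=> idI; apply/seteqP; split=> p.
  apply; split; first exact: is_ideal_eval0.
  move=> q [[c Ic <-]|/= ->]; rewrite /eval0_preimage /= ?hornerC //.
  by rewrite hornerX; case: idI.
move=> Ip0 K [idK SK]; apply: ideal_mem_eval0 => //; apply: SK.
  by right.
by left; exists p.[0].
Qed.

Lemma ideal_genX (R : comNzRingType) :
  ideal_gen [set ('X : {poly R})] = eval0_preimage [set 0].
Proof.
apply/seteqP; split=> p.
  apply; split; first exact/is_ideal_eval0/is_ideal_set0.
  by move=> q /= ->; rewrite /eval0_preimage /= hornerX.
move=> /= p0 K [idK SK]; apply: ideal_mem_eval0 => //; first exact: SK.
by rewrite [p.[0]]p0 polyC0; case: idK.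
Qed.

(** If [i != 0] lies in [I] and [a ^+ 2 \in I], then [a ^+ 2 - i ^+ 2 \in I], so
    [a + i] or [a - i] lies in [I]; either way [a] does. *)
Lemma sdf_absorbing_sqr (R : comNzRingType) (I : set R) :
  sdf_absorbing I -> I <> [set 0] -> sqr_closed I.
Proof.
move=> [/idealr_closedE[idI _] sdfI] I_neq0 a Ia2.
have [I0 ID IM] := idI.
have [i [Ii i_neq0]] : exists i, I i /\ i != 0.
  apply: contra_notP I_neq0 => noi; apply/seteqP; split=> [x Ix|x ->] //=.
  by apply/eqP; apply: contra_notT noi => x_neq0; exists x.
have [->//|a_neq0] := eqVneq a 0.
have [//|//||Iai|Iai] := sdfI a i.
- by apply: is_idealB => //; rewrite expr2; exact: IM.
- by rewrite -[a](addrK i); exact: is_idealB.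
- by rewrite -[a](subrK i); exact: ID.
Qed.

Lemma sdf_absorbing_eval0 (R : comNzRingType) (I : set R) :
  idealr_closed [in I] ->
  sdf_absorbing (eval0_preimage I) <-> sdf_absorbing I /\ sqr_closed I.
Proof.
move=> closedI; have [idI _] := (idealr_closedE I).1 closedI.
split=> [sdfJ|[[_ sdfI] sqrI]].
  have J_neq0 : eval0_preimage I <> [set 0].
    move=> J0; have : eval0_preimage I 'X.
      by rewrite /eval0_preimage /= hornerX; case: idI.
    by rewrite J0 /= => /eqP; rewrite polyX_eq0.
  split; last first.
    move=> a Ia2; have := sdf_absorbing_sqr sdfJ J_neq0 (a := a%:P).
    by rewrite /eval0_preimage /= -polyC_exp !hornerC; exact.
  split=> // a b a_neq0 b_neq0 Iab.
  have := sdfJ.2 a%:P b%:P; rewrite !polyC_eq0 /eval0_preimage /= !hornerE.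
  by apply.
split; first exact: idealr_closed_eval0.
move=> f g _ _; rewrite /eval0_preimage /= !hornerE.
have [->|f0] := eqVneq f.[0] 0.
  rewrite expr0n /= => Ig; left; rewrite add0r; apply: sqrI.
  rewrite -[_ ^+ 2](subKr 0).
  by apply: is_idealB => //; case: idI.
have [->|g0] := eqVneq g.[0] 0; last exact: sdfI.
by rewrite expr0n /= subr0 addr0 => If; left; exact: sqrI.
Qed.

(** Square-zero elements suffice to detect nilpotents: [x ^+ n = 0] gives
    [x ^+ (2 ^ n) = 0], from which [n] square roots recover [x = 0]. *)
Lemma reduced_ringP (R : comNzRingType) :
  reduced_ring R <-> sqr_closed [set (0 : R)].
Proof.
split=> [redR a a2|sqr0 x [n xn]]; first by apply: redR; exists 2.
have : x ^+ (2 ^ n) = 0.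
  by rewrite -(subnK (ltnW (ltn_expl n (ltnSn 1)))) exprD xn mulr0.
elim: {xn}n => [|n IHn]; first by rewrite expn0 expr1.
by rewrite expnSr exprM => /sqr0.
Qed.

Theorem theorem4p8 (R : comNzRingType) :
  (forall I : set R,
     idealr_closed [in I] -> I <> [set 0] ->
     sdf_absorbing (ideal_gen ((@polyC R) @` I `|` [set 'X])) <->
     sdf_absorbing I)
  /\
  (sdf_absorbing (ideal_gen [set ('X : {poly R})]) <->
   reduced_ring R /\ sdf_absorbing [set (0 : R)]).
Proof.
split=> [I closedI I_neq0|].
  have [idI _] := (idealr_closedE I).1 closedI.
  rewrite ideal_gen_polyCX // sdf_absorbing_eval0 //.
  by split=> [[]//|sdfI]; split=> //; exact: sdf_absorbing_sqr.
rewrite ideal_genX (sdf_absorbing_eval0 (idealr_closed_set0 R)) reduced_ringP.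
by split=> -[].
Qed.
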